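(* Let $p$ be an odd prime, $q\in\mathbb{C}_p$ with $|q-1|_p<1$, $h\in\mathbb{Z}$ and $\zeta\in T_p$. Let $n,k\in\mathbb{Z}_+$ with $n>k$. Then $$\int_{\mathbb{Z}_p}B_{k,n}(x,q)\,q^{(h-1)x}\zeta^x\,d\mu_{-q}(x)=\begin{cases}q^{h+1}\zeta E^{(h)}_{n,q^{-1},\zeta^{-1}}+[2]_q, & k=0,\\[1mm] q^{h+1}\zeta\binom{n}{k}\sum_{l=0}^{k}\binom{k}{l}(-1)^{k+l}E^{(h)}_{n-l,q^{-1},\zeta^{-1}}, & k>0.\end{cases}$$ Moreover, $$\sum_{l=0}^{n-k}\binom{n-k}{l}(-1)^lE^{(h)}_{l+k,q,\zeta}=\begin{cases}q^{h+1}\zeta E^{(h)}_{n,q^{-1},\zeta^{-1}}+[2]_q, & k=0,\\[1mm] q^{h+1}\zeta\sum_{l=0}^{k}\binom{k}{l}(-1)^{k+l}E^{(h)}_{n-l,q^{-1},\zeta^{-1}}, & k>0.\end{cases}$$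
   Context: $\mathbb{Z}_p$, $\mathbb{C}_p$ denote the $p$-adic integers and the completion of the algebraic closure of $\mathbb{Q}_p$; $\mathbb{Z}_+=\{0,1,2,\dots\}$. $T_p=\bigcup_{n\ge1}\{\zeta\in\mathbb{C}_p:\zeta^{p^n}=1\}$; for $\zeta\in T_p$ and $y\in\mathbb{Z}_p$, $\zeta^y$ is defined by continuity. For $Q\in\mathbb{C}_p$ with $|Q-1|_p<1$ (applied to $Q=q$ and $Q=q^{-1}$), $[x]_Q=\frac{1-Q^x}{1-Q}$ (so $[2]_q=1+q$), and for uniformly differentiable $f:\mathbb{Z}_p\to\mathbb{C}_p$, $\int_{\mathbb{Z}_p}f(x)\,d\mu_{-Q}(x)=\lim_{N\to\infty}\frac{1+Q}{1+Q^{p^N}}\sum_{x=0}^{p^N-1}f(x)(-Q)^x$. For $\xi\in T_p$ and $n\in\mathbb{Z}_+$, $E^{(h)}_{n,Q,\xi}(x)=\int_{\mathbb{Z}_p}[x+y]_Q^n\xi^y Q^{(h-1)y}\,d\mu_{-Q}(y)$ and $E^{(h)}_{n,Q,\xi}=E^{(h)}_{n,Q,\xi}(0)$. The $q$-Bernstein polynomials are $B_{k,n}(x,q)=\binom{n}{k}[x]_q^k[1-x]_{q^{-1}}^{n-k}$ for $x\in\mathbb{Z}_p$ and $n,k\in\mathbb{Z}_+$. *)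

(* Defs.v *)
From HB Require Import structures.
From mathcomp Require Import all_boot all_order all_algebra.
From mathcomp Require Import all_classical all_reals.
From mathcomp Require Import topology normedtype sequences.

Set Implicit Arguments.
Unset Strict Implicit.
Unset Printing Implicit Defensive.

Import Order.TTheory GRing.Theory Num.Theory.
Import numFieldNormedType.Exports.

Local Open Scope classical_set_scope.
Local Open Scope ring_scope.

Definition vcvg (R : realType) (F : fieldType) (v : F -> R)
    (u : nat -> F) (l : F) : Prop :=
  (fun n => v (u n - l)) @ \oo --> (0 : R).

Definition vcauchy (R : realType) (F : fieldType) (v : F -> R)
    (u : nat -> F) : Prop :=
  forall e : R, 0 < e ->
    exists N : nat, forall m n : nat, (N <= m)%N -> (N <= n)%N ->
      v (u m - u n) < e.

Definition rat_closure (R : realType) (F : fieldType) (v : F -> R) : set F :=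
  [set x | exists r : nat -> rat, vcvg v (fun n => ratr (r n)) x].

Definition algebraic_over (F : fieldType) (S : set F) : set F :=
  [set x | exists f : {poly F},
     [/\ f != 0, (forall i : nat, S f`_i) & root f x]].

(* A model of C_p, with its absolute value normalized by |p| = 1/p.  The closure
   of the rationals is then Q_p; its algebraic elements form an algebraic
   closure of Q_p which is dense in the complete field.  These axioms determine
   the valued field up to isometric isomorphism. *)
Record padicComplex (p : nat) (R : realType) := PadicComplex {
  pc_field :> fieldType;
  pc_abs : pc_field -> R;
  pc_abs_ge0 : forall x, 0 <= pc_abs x;
  pc_abs_eq0 : forall x, pc_abs x = 0 <-> x = 0;
  pc_absM : forall x y, pc_abs (x * y) = pc_abs x * pc_abs y;
  pc_absD : forall x y, pc_abs (x + y) <= Num.max (pc_abs x) (pc_abs y);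
  pc_absp : pc_abs p%:R = p%:R^-1;
  pc_closed : forall f : {poly pc_field}, (1 < size f)%N ->
    (forall i : nat, algebraic_over (rat_closure pc_abs) f`_i) ->
    exists2 x, algebraic_over (rat_closure pc_abs) x & root f x;
  pc_dense : forall (x : pc_field) (e : R), 0 < e ->
    exists2 y, algebraic_over (rat_closure pc_abs) y & pc_abs (x - y) < e;
  pc_complete : forall u : nat -> pc_field, vcauchy pc_abs u ->
    exists l, vcvg pc_abs u l
}.

(* Z_p is the closure of the naturals in C_p; a function on Z_p is represented
   by a function on C_p, whose values outside Z_p are irrelevant. *)
Section PadicComplexTheory.
Variables (p : nat) (R : realType) (C : padicComplex p R).
Implicit Types (Q q xi x y : C) (h : int) (n k : nat).

(* 0 if the sequence diverges *)
Definition pc_lim (u : nat -> C) : C :=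
  xget 0 [set l | vcvg (@pc_abs _ _ C) u l].

Definition Tp : set C :=
  [set z | exists2 n : nat, (1 <= n)%N & z ^+ (p ^ n) = 1].

(* Q ^ y for y in Z_p, by continuity from the powers with natural exponent. *)
Definition zppow Q y : C :=
  xget 0 [set l | forall a : nat -> nat,
    vcvg (@pc_abs _ _ C) (fun i => (a i)%:R) y ->
    vcvg (@pc_abs _ _ C) (fun i => Q ^+ a i) l].

(* At Q = 1 the quotient (1 - Q ^ x) / (1 - Q) is read as its limit x. *)
Definition qnum Q x : C :=
  if Q == 1 then x else (1 - zppow Q x) / (1 - Q).

(* The integral of f over Z_p against mu_{-Q}. *)
Definition fermint Q (f : C -> C) : C :=
  pc_lim (fun N => (1 + Q) / (1 + Q ^+ (p ^ N)) *
                   \sum_(0 <= x < p ^ N) f x%:R * (- Q) ^+ x).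

Definition qEuler_poly h n Q xi x : C :=
  fermint Q (fun y =>
    qnum Q (x + y) ^+ n * zppow xi y * zppow Q ((h - 1)%:~R * y)).

Definition qEuler h n Q xi : C := qEuler_poly h n Q xi 0.

Definition qBernstein k n x q : C :=
  'C(n, k)%:R * qnum q x ^+ k * qnum q^-1 (1 - x) ^+ (n - k).

End PadicComplexTheory.

(* Main.v *)
(* Up to the factor (1 + q) / 2, the integral of f against mu_{-q} is the limit
   J(g) of the alternating sums of g(x) (-1)^x over 0 <= x < p^N, where
   g(x) = f(x) q^x.  For g uniformly continuous on the integers, replacing g(x)
   by g(x + p^N) is harmless in the limit; as p is odd this gives both the
   existence of J(g) and the reflection formula
   J(g(1 - x)) = J(g) - 2 g(0) + 2 g(1).
   Since [1 - x]_{q^-1} = 1 - [x]_q, the integrand of B_{k,n} yields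
   g(x) = [x]_q^k (1 - [x]_q)^(n - k) (zeta q^h)^x up to 'C(n, k).  Expanding
   (1 - [x]_q)^(n - k) gives the sum of the E_{l+k,q,zeta}; reflecting first
   exchanges q, zeta with their inverses, and expanding the other factor gives
   the E_{n-l,q^-1,zeta^-1}.  The boundary term g(1) vanishes because k < n, and
   g(0) is 1 for k = 0 and 0 otherwise. *)
Require Import Defs.
From HB Require Import structures.
From mathcomp Require Import all_boot all_order all_algebra.
From mathcomp Require Import all_classical all_reals.
From mathcomp Require Import topology normedtype sequences.
From mathcomp Require Import zify ring lra.

Set Implicit Arguments.
Unset Strict Implicit.
Unset Printing Implicit Defensive.

Import Order.TTheory GRing.Theory Num.Theory.
Import numFieldNormedType.Exports.

Local Open Scope classical_set_scope.
Local Open Scope ring_scope.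

(** * Elementary estimates for the ultrametric absolute value *)

Section Valuation.
Variables (p : nat) (R : realType) (C : padicComplex p R).
Implicit Types (x y u : C) (e : R) (a n : nat) (m : int).

Lemma pc_abs0 : pc_abs (0 : C) = 0.
Proof. exact/pc_abs_eq0. Qed.

Lemma pc_abs_eq0b x : (pc_abs x == 0) = (x == 0).
Proof. by apply/eqP/eqP => /pc_abs_eq0. Qed.

(** Square roots of 1 cover 1 and -1 at once, which yields both |1| = 1 and |-x| = |x|. *)
Lemma pc_abs_sqr1 x : x * x = 1 -> pc_abs x = 1.
Proof.
move=> xx; suff H : pc_abs x * pc_abs x = 1.
  by apply/eqP; rewrite -(@eqrXn2 _ 2) ?pc_abs_ge0 // expr1n expr2 H.
have n0 : pc_abs (1 : C) != 0 by rewrite pc_abs_eq0b oner_eq0.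
by rewrite -pc_absM xx; apply: (mulfI n0); rewrite -pc_absM !mulr1.
Qed.

Lemma pc_abs1 : pc_abs (1 : C) = 1.
Proof. by apply: pc_abs_sqr1; rewrite mulr1. Qed.

Lemma pc_absN x : pc_abs (- x) = pc_abs x.
Proof. by rewrite -mulN1r pc_absM pc_abs_sqr1 ?mul1r // mulrNN mulr1. Qed.

Lemma pc_distC x y : pc_abs (x - y) = pc_abs (y - x).
Proof. by rewrite -pc_absN opprB. Qed.

Lemma pc_absX x n : pc_abs (x ^+ n) = pc_abs x ^+ n.
Proof. by elim: n => [|n IH]; rewrite ?pc_abs1 // !exprS pc_absM IH. Qed.

Lemma pc_absV x : pc_abs x^-1 = (pc_abs x)^-1.
Proof.
have [->|x0] := eqVneq x 0; first by rewrite invr0 pc_abs0 invr0.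
have a0 : pc_abs x != 0 by rewrite pc_abs_eq0b.
by apply: (mulfI a0); rewrite -pc_absM !divff // pc_abs1.
Qed.

Lemma pc_abs_expz1 u m : pc_abs u = 1 -> pc_abs (u ^ m) = 1.
Proof.
move=> u1; case: m => n; rewrite /exprz ?pc_absV pc_absX u1 expr1n //.
by rewrite invr1.
Qed.

Lemma pc_absD_lt x y e : pc_abs x < e -> pc_abs y < e -> pc_abs (x + y) < e.
Proof. by move=> xe ye; apply: le_lt_trans (pc_absD _ _) _; rewrite gt_max xe. Qed.

Lemma pc_absD_le x y e : pc_abs x <= e -> pc_abs y <= e -> pc_abs (x + y) <= e.
Proof. by move=> xe ye; apply: le_trans (pc_absD _ _) _; rewrite ge_max xe. Qed.

Lemma pc_abs_sum_le (I : Type) (r : seq I) (P : pred I) (F : I -> C) e :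
  0 <= e -> (forall i, P i -> pc_abs (F i) <= e) ->
  pc_abs (\sum_(i <- r | P i) F i) <= e.
Proof.
move=> e0 H; elim/big_ind: _ => [|x y|//]; first by rewrite pc_abs0.
exact: pc_absD_le.
Qed.

Lemma pc_abs_sum_lt (I : Type) (r : seq I) (P : pred I) (F : I -> C) e :
  0 < e -> (forall i, P i -> pc_abs (F i) < e) ->
  pc_abs (\sum_(i <- r | P i) F i) < e.
Proof.
move=> e0 H; elim/big_ind: _ => [|x y|//]; first by rewrite pc_abs0.
exact: pc_absD_lt.
Qed.

Lemma pc_abs_nat_le1 n : pc_abs (n%:R : C) <= 1.
Proof.
elim: n => [|n IH]; first by rewrite pc_abs0.
by rewrite -addn1 natrD; apply: pc_absD_le => //; rewrite pc_abs1.
Qed.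

(** If |u| < 1, then 1 = u + (1 - u) would have absolute value below 1. *)
Lemma pc_abs_near1 u : pc_abs (u - 1) < 1 -> pc_abs u = 1.
Proof.
move=> u1; apply/eqP; rewrite eq_le; apply/andP; split.
  by rewrite -[u](subrK 1) pc_absD_le ?pc_abs1 //; apply: ltW.
rewrite leNgt; apply/negP => ult.
by rewrite pc_distC in u1; have := pc_absD_lt ult u1; rewrite addrC subrK pc_abs1 ltxx.
Qed.

Lemma near1_neq0 u : pc_abs (u - 1) < 1 -> u != 0.
Proof. by move=> /pc_abs_near1 u1; rewrite -pc_abs_eq0b u1 oner_eq0. Qed.

Lemma pc_distM u w e : pc_abs u = 1 -> pc_abs (u - 1) < e -> pc_abs (w - 1) < e ->
  pc_abs (u * w - 1) < e.
Proof.
move=> u1 ue we; have -> : u * w - 1 = u * (w - 1) + (u - 1) by ring.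
by apply: pc_absD_lt => //; rewrite pc_absM u1 mul1r.
Qed.

Lemma pc_distX u n : pc_abs u = 1 -> pc_abs (u ^+ n - 1) <= pc_abs (u - 1).
Proof.
move=> u1; rewrite subrX1 pc_absM ler_piMr ?pc_abs_ge0 //.
by apply: pc_abs_sum_le => // i _; rewrite pc_absX u1 expr1n.
Qed.

Lemma pc_distV u : pc_abs u = 1 -> pc_abs (u^-1 - 1) = pc_abs (u - 1).
Proof.
move=> u1; have u0 : u != 0 by rewrite -pc_abs_eq0b u1 oner_eq0.
have -> : u^-1 - 1 = - (u^-1 * (u - 1)) by rewrite mulrBr mulVf // mulr1 opprB.
by rewrite pc_absN pc_absM pc_absV u1 invr1 mul1r.
Qed.

Lemma pc_distXz u m : pc_abs u = 1 -> pc_abs (u ^ m - 1) <= pc_abs (u - 1).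
Proof.
move=> u1; case: m => n; first exact: pc_distX.
by rewrite /exprz pc_distV; [exact: pc_distX | rewrite pc_absX u1 expr1n].
Qed.

Lemma near1V u : pc_abs (u - 1) < 1 -> pc_abs (u^-1 - 1) < 1.
Proof. by move=> u1; rewrite pc_distV // pc_abs_near1. Qed.

Lemma near1Xz u m : pc_abs (u - 1) < 1 -> pc_abs (u ^ m - 1) < 1.
Proof. by move=> u1; apply: le_lt_trans (pc_distXz _ (pc_abs_near1 u1)) u1. Qed.

Lemma near1M u w : pc_abs (u - 1) < 1 -> pc_abs (w - 1) < 1 ->
  pc_abs (u * w - 1) < 1.
Proof. by move=> u1 w1; apply: pc_distM => //; apply: pc_abs_near1. Qed.

(** * Limits of sequences *)

Lemma vcvgP (u : nat -> C) (l : C) :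
  vcvg (@pc_abs _ _ C) u l <->
  forall e, 0 < e -> exists N, forall n, (N <= n)%N -> pc_abs (u n - l) < e.
Proof.
rewrite /vcvg; split.
  move/cvgrPdist_lt => H e e0; have [N _ HN] := H _ e0.
  by exists N => n /HN /=; rewrite sub0r normrN ger0_norm ?pc_abs_ge0.
move=> H; apply/cvgrPdist_lt => e e0; have [N HN] := H _ e0.
by exists N => // n /= /HN; rewrite sub0r normrN ger0_norm ?pc_abs_ge0.
Qed.

Lemma vcvg_cst (l : C) : vcvg (@pc_abs _ _ C) (fun=> l) l.
Proof. by apply/vcvgP => e e0; exists 0%N => n _; rewrite subrr pc_abs0. Qed.

Lemma vcvgD (u v : nat -> C) (l l' : C) :
  vcvg (@pc_abs _ _ C) u l -> vcvg (@pc_abs _ _ C) v l' ->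
  vcvg (@pc_abs _ _ C) (fun n => u n + v n) (l + l').
Proof.
move=> /vcvgP H /vcvgP H'; apply/vcvgP => e e0.
have [N HN] := H _ e0; have [N' HN'] := H' _ e0.
exists (maxn N N') => n; rewrite geq_max => /andP[/HN Nn /HN' N'n].
by rewrite opprD addrACA; apply: pc_absD_lt.
Qed.

Lemma vcvgM (u v : nat -> C) (l l' : C) :
  vcvg (@pc_abs _ _ C) u l -> vcvg (@pc_abs _ _ C) v l' ->
  vcvg (@pc_abs _ _ C) (fun n => u n * v n) (l * l').
Proof.
move=> /vcvgP H /vcvgP H'; apply/vcvgP => e e0.
set K := pc_abs l + pc_abs l' + 1.
have K0 : 0 < K by rewrite ltr_wpDl // addr_ge0 ?pc_abs_ge0.
have lK : pc_abs l <= K by rewrite /K; have := pc_abs_ge0 l'; lra.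
have l'K : pc_abs l' <= K by rewrite /K; have := pc_abs_ge0 l; lra.
(* Dividing by K absorbs the factors |l| and |l'|; the minimum with 1 takes care of the product of
   the two errors. *)
have d0 : 0 < Num.min 1 e / K by rewrite divr_gt0 // lt_min ltr01.
have K1 : 1 <= K by rewrite /K lerDr addr_ge0 ?pc_abs_ge0.
have [N HN] := H _ d0; have [N' HN'] := H' _ d0.
exists (maxn N N') => n; rewrite geq_max => /andP[/HN].
rewrite ltr_pdivlMr // lt_min => /andP[a1 ae] /HN'.
rewrite ltr_pdivlMr // lt_min => /andP[b1 be].
have -> : u n * v n - l * l' =
  (u n - l) * (v n - l') + (u n - l) * l' + l * (v n - l') by ring.
have A0 := pc_abs_ge0 (u n - l); have B0 := pc_abs_ge0 (v n - l').
apply: pc_absD_lt; first apply: pc_absD_lt; rewrite pc_absM.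
- apply: le_lt_trans ae; apply: ler_wpM2l => //; apply: (le_trans _ K1).
  by apply: le_trans (ltW b1); rewrite ler_peMr.
- by apply: le_lt_trans ae; apply: ler_wpM2l.
- by apply: le_lt_trans be; rewrite mulrC; apply: ler_wpM2l.
Qed.

Lemma vcvgZ c (u : nat -> C) (l : C) : vcvg (@pc_abs _ _ C) u l ->
  vcvg (@pc_abs _ _ C) (fun n => c * u n) (c * l).
Proof. exact: vcvgM (vcvg_cst c). Qed.

(** Once |u n - l| < |l|, the ultrametric inequality forces |u n| = |l|, so the inverses differ by
    exactly |u n - l| / |l|^2. *)
Lemma vcvgV (u : nat -> C) (l : C) : l != 0 ->
  vcvg (@pc_abs _ _ C) u l -> vcvg (@pc_abs _ _ C) (fun n => (u n)^-1) l^-1.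
Proof.
move=> l0 /vcvgP H; apply/vcvgP => e e0.
set L := pc_abs l.
have L0 : 0 < L by rewrite lt_def pc_abs_ge0 pc_abs_eq0b l0.
have d0 : 0 < Num.min L (e * L * L) by rewrite lt_min L0 !mulr_gt0.
have [N HN] := H _ d0; exists N => n /HN; rewrite lt_min => /andP[uL ue].
have unL : pc_abs (u n) = L.
  apply/eqP; rewrite eq_le; apply/andP; split.
    by rewrite -[u n](subrK l); apply: pc_absD_le => //; apply: ltW.
  rewrite leNgt; apply/negP => unL; rewrite pc_distC in uL.
  by have := pc_absD_lt uL unL; rewrite subrK ltxx.
have un0 : u n != 0 by rewrite -pc_abs_eq0b unL gt_eqF.
have -> : (u n)^-1 - l^-1 = - ((u n - l) / (u n * l)) by field; rewrite l0 un0.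
by rewrite pc_absN pc_absM pc_absV pc_absM unL ltr_pdivrMr ?mulr_gt0 // mulrA.
Qed.

Lemma vcvg_unique (u : nat -> C) (l l' : C) :
  vcvg (@pc_abs _ _ C) u l -> vcvg (@pc_abs _ _ C) u l' -> l = l'.
Proof.
move=> /vcvgP H /vcvgP H'; apply/eqP; rewrite -subr_eq0 -pc_abs_eq0b.
rewrite -[_ == _]negbK; apply/negP => n0.
have d0 : 0 < pc_abs (l - l') by rewrite lt_def n0 pc_abs_ge0.
have [N HN] := H _ d0; have [N' HN'] := H' _ d0.
have := HN _ (leq_maxl N N'); rewrite pc_distC => lu.
by have := pc_absD_lt lu (HN' _ (leq_maxr N N')); rewrite addrA subrK ltxx.
Qed.

Lemma vcvg_sum (I : Type) (r : seq I) (u : I -> nat -> C) (l : I -> C) :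
  (forall i, vcvg (@pc_abs _ _ C) (u i) (l i)) ->
  vcvg (@pc_abs _ _ C) (fun n => \sum_(i <- r) u i n) (\sum_(i <- r) l i).
Proof.
move=> H; elim: r => [|i r IH].
  rewrite big_nil; under eq_fun do rewrite big_nil; exact: vcvg_cst.
by rewrite big_cons; under eq_fun do rewrite big_cons; apply: vcvgD.
Qed.

Lemma pc_limE (u : nat -> C) (l : C) : vcvg (@pc_abs _ _ C) u l -> pc_lim u = l.
Proof.
by move=> ul; apply: xget_unique => // l' ul'; apply: vcvg_unique ul' ul.
Qed.

Lemma vcvg_near (u v : nat -> C) (l : C) :
  (forall e, 0 < e -> exists N, forall n, (N <= n)%N -> pc_abs (u n - v n) < e) ->
  vcvg (@pc_abs _ _ C) v l -> vcvg (@pc_abs _ _ C) u l.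
Proof.
move=> H /vcvgP H'; apply/vcvgP => e e0.
have [N HN] := H _ e0; have [N' HN'] := H' _ e0.
exists (maxn N N') => n; rewrite geq_max => /andP[/HN Nn /HN' N'n].
by rewrite -[u n](subrK (v n)) -addrA; apply: pc_absD_lt.
Qed.

End Valuation.

(** * Two finite sum identities *)

Lemma sum_sign (V : pzRingType) n :
  \sum_(0 <= i < n) (-1) ^+ i = (odd n)%:R :> V.
Proof.
elim: n => [|n IH]; first by rewrite big_nil.
rewrite big_nat_recr //= IH -signr_odd; case: (odd n); first exact: subrr.
exact: add0r.
Qed.

(** The end terms are split off because, for n prime, all remaining binomial coefficients are
    divisible by n. *)
Lemma exprD1_prime (V : comPzRingType) (t : V) n : (0 < n)%N ->
  (t + 1) ^+ n = t ^+ n + 1 + \sum_(1 <= i < n) t ^+ (n - i) *+ 'C(n, i).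
Proof.
case: n => // n _; rewrite exprDn -(big_mkord xpredT
  (fun i => t ^+ (n.+1 - i) * 1 ^+ i *+ 'C(n.+1, i))) big_nat_recr //=.
rewrite big_ltn // subn0 bin0 mulr1 subnn binn expr1n mul1r addrAC.
by under eq_bigr do rewrite expr1n mulr1.
Qed.

(** * Absolute values of integers, and elements close to 1 *)

Section Padic.
Variables (p : nat) (R : realType) (C : padicComplex p R).
Hypotheses (p_pr : prime p) (p_odd : odd p).
Implicit Types (x y u Q : C) (e : R) (a n N M : nat) (m z : int) (g : int -> C).

Let absp_lt1 : pc_abs (p%:R : C) < 1.
Proof. by rewrite pc_absp invf_lt1 ?ltr1n ?ltr0n ?prime_gt0 ?prime_gt1. Qed.

(** A Bezout relation 1 = d p - c a would give |1| < 1 if |a| < 1. *)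
Lemma pc_abs_coprime a : coprime p a -> pc_abs (a%:R : C) = 1.
Proof.
move=> /eqP cpa; apply/eqP; rewrite eq_le pc_abs_nat_le1 leNgt.
apply/negP => a1; have [c _ /dvdnP[d]] := Bezoutl a (prime_gt0 p_pr).
rewrite cpa => /(congr1 (fun i => i%:R : C)); rewrite natrD !natrM => E.
have : pc_abs (d%:R * p%:R - c%:R * a%:R : C) < 1.
  apply: pc_absD_lt; rewrite ?pc_absN pc_absM.
    by apply: le_lt_trans absp_lt1; rewrite ler_piMl ?pc_abs_ge0 ?pc_abs_nat_le1.
  by apply: le_lt_trans a1; rewrite ler_piMl ?pc_abs_ge0 ?pc_abs_nat_le1.
by rewrite -E addrK pc_abs1 ltxx.
Qed.

Lemma pc_abs2 : pc_abs (2 : C) = 1.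
Proof. by rewrite pc_abs_coprime // coprimen2. Qed.

Lemma pc_neq2 : (2 : C) != 0.
Proof. by rewrite -pc_abs_eq0b pc_abs2 oner_eq0. Qed.

Lemma pc_abs_int m : pc_abs (m%:~R : C) = pc_abs (`|m|%N%:R : C).
Proof.
by case: m => n //; rewrite NegzE abszN mulrNz pc_absN.
Qed.

(** If |m| = d p^v as a natural number, with d prime to p, its p-adic absolute value is |p|^v, which
    rules out v < N. *)
Lemma dvdz_pc_abs m N : pc_abs (m%:~R : C) < pc_abs (p%:R ^+ N : C) ->
  exists z, m = z * (p ^ N)%N.
Proof.
rewrite pc_abs_int => lt; suff /dvdzP : ((p ^ N)%N %| m)%Z by [].
rewrite dvdzE absz_nat.
have [->|m0] := posnP `|m|%N; first exact: dvdn0.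
rewrite pfactor_dvdn // leqNgt; apply/negP => lN.
have [d cpd E] := pfactor_coprime p_pr m0; move: lt; rewrite {1}E natrM pc_absM.
rewrite pc_abs_coprime // mul1r natrX !pc_absX ltNge => /negP; apply.
by rewrite ler_wiXn2l ?pc_abs_ge0 ?(ltW absp_lt1) ?(ltnW lN).
Qed.

Lemma exp_small (c e : R) : 0 <= c -> c < 1 -> 0 < e ->
  exists M, forall N, (M <= N)%N -> c ^+ N < e.
Proof.
move=> c0 c1 e0; have /cvg_expr/cvgrPdist_lt/(_ e e0)[M _ HM] : `|c| < 1.
  by rewrite ger0_norm.
by exists M => N /HM /=; rewrite sub0r normrN ger0_norm ?exprn_ge0.
Qed.

Lemma expp_cvg e : 0 < e ->
  exists M, forall N, (M <= N)%N -> pc_abs ((p ^ N)%N%:R : C) < e.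
Proof.
move=> e0; have [M HM] := exp_small (pc_abs_ge0 _) absp_lt1 e0.
by exists M => N /HM; rewrite natrX pc_absX.
Qed.

(* w^p - 1 = (w - 1) (p + \sum_(i < p) (w^i - 1)), so taking p-th powers
   contracts the distance to 1. *)
Lemma near1_expp_cvg u e : pc_abs (u - 1) < 1 -> 0 < e ->
  exists M, forall N, (M <= N)%N -> pc_abs (u ^+ (p ^ N) - 1) < e.
Proof.
move=> u1 e0; set c := Num.max (pc_abs (p%:R : C)) (pc_abs (u - 1)).
have c0 : 0 <= c by rewrite le_max pc_abs_ge0.
have c1 : c < 1 by rewrite gt_max absp_lt1.
have step N : pc_abs (u ^+ (p ^ N) - 1) <= c ^+ N.+1.
  elim: N => [|N IH]; first by rewrite !expr1 le_max lexx orbT.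
  have w1 : pc_abs (u ^+ (p ^ N)) = 1 by rewrite pc_absX pc_abs_near1 ?expr1n.
  rewrite expnSr exprM subrX1 pc_absM exprSr.
  apply: ler_pM; rewrite ?pc_abs_ge0 //.
  set w := u ^+ _ in IH w1 *.
  have -> : \sum_(i < p) w ^+ i = p%:R + \sum_(i < p) (w ^+ i - 1).
    by rewrite sumrB sumr_const card_ord addrCA subrr addr0.
  apply: pc_absD_le; first by rewrite le_max lexx.
  apply: pc_abs_sum_le => // i _; apply: le_trans (pc_distX _ w1) _.
  by apply: le_trans IH _; rewrite exprS ler_piMr // exprn_ile1 // ltW.
have [M HM] := exp_small c0 c1 e0.
by exists M => N MN; apply: le_lt_trans (step N) _; apply: HM; apply: leqW.
Qed.

(** With t = x - 1, expanding (t + 1)^p shows that t^p is x^p - 1 minus terms divisible by p. As |t|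
    <= 1, these have absolute value at most |p| < 1, so |t|^p < 1. *)
Lemma near1_rootp x : pc_abs (x ^+ p - 1) < 1 -> pc_abs (x - 1) < 1.
Proof.
move=> xp; have p0 := prime_gt0 p_pr.
have x1 : pc_abs x = 1.
  apply/eqP; rewrite -(@pexpr_eq1 _ _ p) ?pc_abs_ge0 //.
  by rewrite -pc_absX pc_abs_near1.
have t1 : pc_abs (x - 1) <= 1 by apply: pc_absD_le; rewrite ?pc_absN ?x1 ?pc_abs1.
rewrite -(expr_lt1 p0) ?pc_abs_ge0 //.
have := @exprD1_prime _ (x - 1) p p0; rewrite subrK => E.
rewrite -pc_absX.
have -> : (x - 1) ^+ p =
    x ^+ p - 1 - \sum_(1 <= i < p) (x - 1) ^+ (p - i) *+ 'C(p, i).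
  by rewrite E; ring.
apply: pc_absD_lt => //; rewrite pc_absN big_nat_cond.
apply: pc_abs_sum_lt => // i /andP[ip _].
have /dvdnP[d ->] := prime_dvd_bin p_pr ip.
rewrite -mulr_natr natrM !pc_absM pc_absX.
apply: le_lt_trans absp_lt1; rewrite mulrA ler_piMl ?pc_abs_ge0 //.
by rewrite mulr_ile1 ?exprn_ge0 ?pc_abs_ge0 ?exprn_ile1 ?pc_abs_ge0 ?pc_abs_nat_le1.
Qed.

Lemma near1_Tp x : Tp x -> pc_abs (x - 1) < 1.
Proof.
case=> n _; elim: n x => [|n IH] x; first by rewrite expr1 => ->; rewrite subrr pc_abs0.
by rewrite expnS exprM => /IH; apply: near1_rootp.
Qed.

(** * Powers and q-numbers at integer arguments *)

(** Two facts are needed: every natural sequence tending to m yields the limit Q ^ m, and such a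
    sequence exists. Without the second, every l would satisfy the defining condition vacuously. *)
Lemma zppow_int Q m : pc_abs (Q - 1) < 1 -> zppow Q m%:~R = Q ^ m.
Proof.
move=> Q1; have Qa := pc_abs_near1 Q1; have Q0 := near1_neq0 Q1.
have cvgQ (a : nat -> nat) :
    vcvg (@pc_abs _ _ C) (fun i => (a i)%:R) m%:~R ->
    vcvg (@pc_abs _ _ C) (fun i => Q ^+ a i) (Q ^ m).
  move=> /vcvgP am; apply/vcvgP => e e0.
  (* Q ^ (p^M) is within e of 1, and eventually a n differs from m by a multiple of p^M. *)
  have [M /(_ _ (leqnn M)) HM] := near1_expp_cvg Q1 e0.
  have pM : 0 < pc_abs (p%:R ^+ M : C).
    by rewrite pc_absX exprn_gt0 // pc_absp invr_gt0 ltr0n prime_gt0.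
  have [N HN] := am _ pM; exists N => n /HN.
  rewrite -[(a n)%:R]/((Posz (a n))%:~R) -rmorphB => /dvdz_pc_abs[z E].
  rewrite exprnP -(subrK m (Posz (a n))) expfzDr // E mulrC [z * _]mulrC -exprz_exp.
  rewrite -[X in _ - X]mulr1 -mulrBr pc_absM pc_abs_expz1 // mul1r -exprnP.
  by apply: le_lt_trans (pc_distXz _ _) HM; rewrite pc_absX Qa expr1n.
have [a am] : exists a : nat -> nat,
    vcvg (@pc_abs _ _ C) (fun i => (a i)%:R) m%:~R.
  case: (intP m) => [|n|n].
  - by exists (fun=> 0%N); apply: vcvg_cst.
  - by exists (fun=> n.+1); apply: vcvg_cst.
  (* A negative integer is approached by naturals after adding a multiple of p^i. *)
  exists (fun i => n.+1 * p ^ i - n.+1)%N; apply/vcvgP => e e0.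
  have [M HM] := expp_cvg e0; exists M => i /HM; apply: le_lt_trans.
  rewrite natrB; last by rewrite leq_pmulr // expn_gt0 prime_gt0.
  rewrite mulrNz opprK subrK natrM pc_absM ler_piMl ?pc_abs_ge0 //.
  exact: pc_abs_nat_le1.
apply: xget_unique => // l Hl; apply: vcvg_unique (Hl _ am) (cvgQ _ am).
Qed.

(** The q-number at integers, negative ones included: the integrals sample only naturals, but
    reflection evaluates at 1 - m. *)
Definition qint Q m : C := if Q == 1 then m%:~R else (1 - Q ^ m) / (1 - Q).

Lemma qnum_int Q m : pc_abs (Q - 1) < 1 -> qnum Q m%:~R = qint Q m.
Proof. by move=> Q1; rewrite /qnum /qint zppow_int. Qed.

Lemma qintD Q m z : Q != 0 -> qint Q (m + z) = qint Q m + Q ^ m * qint Q z.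
Proof.
move=> Q0; rewrite /qint; have [->|Q1] := eqVneq Q 1.
  by rewrite exp1rz mul1r rmorphD.
by rewrite expfzDr //; field; rewrite subr_eq0 eq_sym.
Qed.

Lemma qint0 Q : qint Q 0 = 0.
Proof. by rewrite /qint expr0z subrr mul0r if_same. Qed.

Lemma qint1 Q : qint Q 1 = 1.
Proof.
rewrite /qint expr1z; have [_ //|Q1] := eqVneq Q 1.
by rewrite divff // subr_eq0 eq_sym.
Qed.

Lemma qint2 Q : qint Q 2 = 1 + Q.
Proof.
rewrite /qint; have [->//|Q1] := eqVneq Q 1.
by rewrite -exprnP; field; rewrite subr_eq0 eq_sym.
Qed.

Lemma qint_invB Q m : Q != 0 -> qint Q^-1 (1 - m) = 1 - qint Q m.
Proof.
move=> Q0; rewrite /qint invr_eq1; have [_|Q1] := eqVneq Q 1.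
  by rewrite rmorphB.
rewrite exprz_inv opprB expfzDr // -invr_expz expr1z.
by field; rewrite Q0 !subr_eq0 Q1 eq_sym Q1.
Qed.

(** The quotient gives no direct bound when 1 - Q is small. The addition rule [qintD] instead builds
    [m]_Q from [1]_Q = 1 and [-1]_Q = -Q^-1, with factors of absolute value 1. *)
Lemma qint_le1 Q m : pc_abs (Q - 1) < 1 -> pc_abs (qint Q m) <= 1.
Proof.
move=> Q1; have Q0 := near1_neq0 Q1; have Qa := pc_abs_near1 Q1.
have qN1 : qint Q (- 1) = - Q^-1.
  have := qintD 1 (- 1) Q0; rewrite subrr qint0 qint1 expr1z => E.
  by apply: (mulfI Q0); rewrite mulrN divff //; apply/eqP; rewrite -addr_eq0 addrC -E.
elim/int_ind: m => [|n IH|n IH]; first by rewrite qint0 pc_abs0.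
  rewrite -[Posz n.+1]/(1 + Posz n) qintD // qint1 expr1z.
  by apply: pc_absD_le; rewrite ?pc_abs1 // pc_absM Qa mul1r.
rewrite -[Posz n.+1]/(1 + Posz n) opprD qintD // qN1.
apply: pc_absD_le; first by rewrite pc_absN pc_absV Qa invr1.
by rewrite pc_absM pc_abs_expz1 // mul1r.
Qed.

Lemma qint_expp_cvg Q e : pc_abs (Q - 1) < 1 -> 0 < e ->
  exists M, forall N, (M <= N)%N -> pc_abs (qint Q (p ^ N)%N) < e.
Proof.
move=> Q1 e0; rewrite /qint; have [_|Qn1] := eqVneq Q 1; first exact: expp_cvg.
have D0 : 0 < pc_abs (1 - Q).
  by rewrite lt_def pc_abs_ge0 pc_abs_eq0b subr_eq0 eq_sym Qn1.
have [M HM] := near1_expp_cvg Q1 (mulr_gt0 e0 D0).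
exists M => N /HM; rewrite -exprnP pc_absM pc_absV ltr_pdivrMr //.
by rewrite pc_distC.
Qed.

(* Continuity is for the p-adic topology on the integers; the bound by 1 only
   serves to make the class stable under products. *)
Definition ucont g := (forall m, pc_abs (g m) <= 1) /\
  forall e, 0 < e -> exists M, forall N, (M <= N)%N ->
    forall m, pc_abs (g (m + (p ^ N)%N) - g m) < e.

(** * Stability of uniform continuity on the integers *)

Lemma ucont_exp u : pc_abs (u - 1) < 1 -> ucont (fun m => u ^ m).
Proof.
move=> u1; have ua := pc_abs_near1 u1; split=> [m|e e0].
  by rewrite pc_abs_expz1.
have [M HM] := near1_expp_cvg u1 e0; exists M => N /HM lt m.
rewrite expfzDr ?near1_neq0 // -[X in _ - X]mulr1 -mulrBr pc_absM.
by rewrite pc_abs_expz1 // mul1r.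
Qed.

Lemma ucont_qint Q : pc_abs (Q - 1) < 1 -> ucont (qint Q).
Proof.
move=> Q1; split=> [m|e e0]; first exact: qint_le1.
have [M HM] := qint_expp_cvg Q1 e0; exists M => N /HM lt m.
rewrite qintD ?near1_neq0 // addrC addKr pc_absM pc_abs_expz1 ?mul1r //.
exact: pc_abs_near1.
Qed.

Lemma ucont_onem g : ucont g -> ucont (fun m => 1 - g m).
Proof.
case=> g1 gc; split=> [m|e /gc[M HM]].
  by apply: pc_absD_le; rewrite ?pc_absN ?pc_abs1.
exists M => N /HM H m; rewrite opprB addrC addrA subrK.
by rewrite pc_distC; apply: H.
Qed.

Lemma ucontM g g' : ucont g -> ucont g' -> ucont (fun m => g m * g' m).
Proof.
move=> [g1 gc] [g'1 g'c]; split=> [m|e e0].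
  by rewrite pc_absM mulr_ile1 ?pc_abs_ge0.
have [M HM] := gc _ e0; have [M' HM'] := g'c _ e0.
exists (maxn M M') => N; rewrite geq_max => /andP[/HM H /HM' H'] m.
have -> (a b c d : C) : a * b - c * d = a * (b - d) + (a - c) * d by ring.
apply: pc_absD_lt; rewrite pc_absM.
  by apply: le_lt_trans (H' m); rewrite ler_piMl ?pc_abs_ge0.
by apply: le_lt_trans (H m); rewrite ler_piMr ?pc_abs_ge0.
Qed.

Lemma ucontX g n : ucont g -> ucont (fun m => g m ^+ n).
Proof.
move=> rg; elim: n => [|n IH].
  split=> [m|e e0]; first by rewrite expr0 pc_abs1.
  by exists 0%N => N _ m; rewrite !expr0 subrr pc_abs0.
by under [X in ucont X]eq_fun do rewrite exprS; apply: ucontM.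
Qed.

(** * Alternating sums: convergence and reflection *)

Definition altsum g N : C := \sum_(0 <= x < p ^ N) g x * (-1) ^+ x.

Lemma odd_expp N : odd (p ^ N).
Proof. by rewrite oddX p_odd orbT. Qed.

(** The range below p^(N+1) splits into p blocks of length p^N. Since p^N is odd, block i carries
    the sign (-1)^i, and each block is compared with the first one term by term. *)
Lemma altsum_step g e N : 0 < e ->
  (forall m, pc_abs (g (m + (p ^ N)%N) - g m) < e) ->
  pc_abs (altsum g N.+1 - altsum g N) < e.
Proof.
move=> e0 H.
have Hi i m : pc_abs (g (m + (i * p ^ N)%N) - g m) < e.
  elim: i => [|i IH]; first by rewrite addr0 subrr pc_abs0.
  rewrite -[g (_ + _)](subrK (g (m + (i * p ^ N)%N))) -addrA.
  by apply: pc_absD_lt => //; rewrite mulSn PoszD addrCA addrC.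
have -> : altsum g N.+1 - altsum g N = \sum_(0 <= i < p)
    \sum_(0 <= j < p ^ N) (-1) ^+ (i + j) * (g (Posz j + (i * p ^ N)%N) - g j).
  (* As p is odd, the block signs add up to 1, so the shorter sum equals p signed copies of
     itself. *)
  have -> : altsum g N = \sum_(0 <= i < p) \sum_(0 <= j < p ^ N)
      (-1) ^+ (i + j) * g j.
    have s1 : \sum_(0 <= i < p) (-1) ^+ i = 1 :> C by rewrite sum_sign p_odd.
    rewrite -[LHS]mul1r -[X in X * _ = _]s1 mulr_suml.
    apply: eq_bigr => i _; rewrite mulr_sumr; apply: eq_bigr => j _.
    by rewrite exprD; ring.
  rewrite /altsum expnS big_nat_mul -sumrB; apply: eq_bigr => i _.
  rewrite -{1}[(i * p ^ N)%N]add0n big_addn mulSn addnK -sumrB.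
  apply: eq_bigr => j _; rewrite PoszD mulrBr; congr (_ - _).
  rewrite mulrC addnC; congr (_ * _).
  by rewrite !exprD -(signr_odd _ (i * _)) oddM odd_expp andbT signr_odd.
apply: pc_abs_sum_lt => // i _; apply: pc_abs_sum_lt => // j _.
by rewrite pc_absM pc_absX pc_absN pc_abs1 expr1n mul1r.
Qed.

(** In an ultrametric field, consecutive differences below e from M on keep all later sums within e
    of one another. *)
Lemma altsum_cvg g : ucont g -> exists l, vcvg (@pc_abs _ _ C) (altsum g) l.
Proof.
case=> _ gc; apply: pc_complete => e e0; have [M HM] := gc _ e0.
have HS n : pc_abs (altsum g (M + n) - altsum g M) < e.
  elim: n => [|n IH]; first by rewrite addn0 subrr pc_abs0.
  rewrite -[altsum g (M + n.+1)](subrK (altsum g (M + n))) -addrA.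
  apply: pc_absD_lt => //; rewrite addnS; apply: altsum_step => //.
  by apply: HM; apply: leq_addr.
exists M => m n /subnKC <- /subnKC <-.
rewrite -[altsum g (M + (m - M))](subrK (altsum g M)) -addrA.
by apply: pc_absD_lt => //; rewrite pc_distC.
Qed.

(** A shift by two preserves the signs, so only two terms at each end change. *)
Lemma altsum_shift2 g n :
  \sum_(0 <= i < n) g i.+2 * (-1) ^+ i =
  \sum_(0 <= i < n) g i * (-1) ^+ i - g 0 + g 1 + (-1) ^+ n * (g n - g n.+1).
Proof.
elim: n => [|n IH]; first by rewrite !big_nil expr0; ring.
by rewrite !big_nat_recr //= IH !exprS; ring.
Qed.

(* Modulo the quasi-period p^N, 1 - x is p^N + 1 - x, which runs through
   2, ..., p^N + 1 with the same sign since p^N is odd. *)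
Lemma altsum_reflect g l : ucont g -> vcvg (@pc_abs _ _ C) (altsum g) l ->
  vcvg (@pc_abs _ _ C) (altsum (fun m => g (1 - m))) (l - 2 * g 0 + 2 * g 1).
Proof.
move=> [_ gc] gl.
apply: (@vcvg_near _ _ _ _ (fun N => altsum g N + (- 2 * g 0 + 2 * g 1))).
  move=> e /[dup] e0 /gc[M HM]; exists M => N /HM H.
  pose T := \sum_(0 <= i < p ^ N) g i.+2 * (-1) ^+ i.
  have TE : T = \sum_(0 <= i < p ^ N) g (1 - Posz i + (p ^ N)%N) * (-1) ^+ i.
    rewrite big_nat_rev /= add0n; apply: eq_big_nat => i /andP[_ iN].
    congr (g _ * _); first lia.
    by rewrite -[in RHS]signr_odd oddB // odd_expp /= negbK signr_odd.
  rewrite -[altsum _ N](subrK T) -addrA; apply: pc_absD_lt.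
    rewrite TE /altsum -sumrB; apply: pc_abs_sum_lt => // i _.
    by rewrite -mulrBl pc_absM pc_absX pc_absN pc_abs1 expr1n mulr1 pc_distC.
  rewrite /T altsum_shift2 -signr_odd odd_expp expr1.
  rewrite -/(altsum g N).
  (* The end values g(p^N) and g(p^N + 1) are close to g(0) and g(1), which doubles the boundary
     terms. *)
  have -> : altsum g N - g 0 + g 1 + -1 * (g (p ^ N)%N - g (p ^ N).+1) -
      (altsum g N + (- 2 * g 0 + 2 * g 1)) =
      (g (1 + Posz (p ^ N)) - g 1) - (g (0 + Posz (p ^ N)) - g 0).
    by rewrite add0r; ring.
  by apply: pc_absD_lt; rewrite ?pc_absN; apply: H.
by rewrite -addrA -mulNr; apply: vcvgD => //; apply: vcvg_cst.
Qed.

(** * Integrals as limits of alternating sums *)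

(** The prefactor tends to (1 + Q) / 2 because Q ^ (p^N) tends to 1, and Q^x is moved from (-Q)^x
    into g. *)
Lemma fermint_altsum Q (f : C -> C) g l : pc_abs (Q - 1) < 1 ->
  (forall n, f n%:R * Q ^+ n = g n) -> vcvg (@pc_abs _ _ C) (altsum g) l ->
  fermint Q f = (1 + Q) / 2 * l.
Proof.
move=> Q1 fg gl; apply: pc_limE; apply: vcvgM.
  apply: vcvgZ; apply: vcvgV; first exact: pc_neq2.
  rewrite -[2]/(1 + 1); apply: vcvgD; first exact: vcvg_cst.
  by apply/vcvgP => e; apply: near1_expp_cvg.
congr (vcvg _ _ _): gl; apply/funext => N; apply: eq_bigr => i _.
by rewrite -fg [(- Q) ^+ i]exprNn -mulrA [Q ^+ i * _]mulrC.
Qed.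

Definition altlim g : C := pc_lim (altsum g).

Lemma altlimP g : ucont g -> vcvg (@pc_abs _ _ C) (altsum g) (altlim g).
Proof. by case/altsum_cvg => l gl; rewrite /altlim (pc_limE gl). Qed.

Lemma altsumZ_cvg c g : ucont g ->
  vcvg (@pc_abs _ _ C) (altsum (fun m => c * g m)) (c * altlim g).
Proof.
move=> /altlimP/(vcvgZ c); congr (vcvg _ _ _); apply/funext => N.
rewrite mulr_sumr; apply: eq_bigr => i _; exact: mulrA.
Qed.

Lemma altlimZ c g : ucont g -> altlim (fun m => c * g m) = c * altlim g.
Proof. by move=> rg; apply/pc_limE/altsumZ_cvg. Qed.

Lemma altlim_reflect g : ucont g ->
  altlim (fun m => g (1 - m)) = altlim g - 2 * g 0 + 2 * g 1.
Proof. by move=> rg; apply/pc_limE/altsum_reflect/altlimP. Qed.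

(** Used twice: with q for the alternating sum of the E_{l+k}, and with q^-1, after reflection, for
    the sum of the E_{n-l}. *)
Lemma altlim_binom g g' i j : ucont g -> ucont g' ->
  altlim (fun m => g m ^+ i * (1 - g m) ^+ j * g' m) =
  \sum_(0 <= l < j.+1)
     'C(j, l)%:R * (-1) ^+ l * altlim (fun m => g m ^+ (l + i) * g' m).
Proof.
move=> rg rg'.
have cv l : vcvg (@pc_abs _ _ C)
    (fun N => 'C(j, l)%:R * (-1) ^+ l * altsum (fun m => g m ^+ (l + i) * g' m) N)
    ('C(j, l)%:R * (-1) ^+ l * altlim (fun m => g m ^+ (l + i) * g' m)).
  by apply: vcvgZ; apply: altlimP; apply: ucontM => //; apply: ucontX.
apply: pc_limE; have := vcvg_sum (index_iota 0 j.+1) cv.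
congr (vcvg _ _ _); apply/funext => N; rewrite /altsum.
under eq_bigr do rewrite mulr_sumr.
rewrite exchange_big /=; apply: eq_bigr => x _.
rewrite exprBn -(big_mkord xpredT
  (fun l => (-1) ^+ l * 1 ^+ (j - l) * g x ^+ l *+ 'C(j, l))).
rewrite mulr_sumr !mulr_suml; apply: eq_bigr => l _.
by rewrite expr1n mulr1 -mulr_natr exprD; ring.
Qed.

(** * Euler numbers and Bernstein polynomials as alternating limits *)

(** The factor Q^n from the measure raises the exponent h - 1 to h, so all weights merge into one
    geometric sequence. *)
Lemma zppow_weight h Q xi n : pc_abs (Q - 1) < 1 -> pc_abs (xi - 1) < 1 ->
  zppow xi n%:R * zppow Q ((h - 1)%:~R * n%:R) * Q ^+ n = (xi * Q ^ h) ^ (Posz n).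
Proof.
move=> Q1 xi1; rewrite -[n%:R]/((Posz n)%:~R) -rmorphM !zppow_int //.
rewrite exprnP -mulrA -expfzDr ?near1_neq0 // expfzMl exprz_exp.
by congr (_ * Q ^ _); rewrite mulrBl mul1r subrK.
Qed.

Lemma qEulerE h n Q xi : pc_abs (Q - 1) < 1 -> pc_abs (xi - 1) < 1 ->
  qEuler h n Q xi =
  (1 + Q) / 2 * altlim (fun m => qint Q m ^+ n * (xi * Q ^ h) ^ m).
Proof.
move=> Q1 xi1; apply: fermint_altsum => //; last first.
  apply: altlimP; apply: ucontM.
    by apply: ucontX; apply: ucont_qint.
  by apply: ucont_exp; apply: near1M => //; apply: near1Xz.
move=> m; rewrite add0r -zppow_weight // -[in qnum _ _]/((Posz m)%:~R) qnum_int //.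
by rewrite !mulrA.
Qed.

Lemma qBernstein_int k n m Q : pc_abs (Q - 1) < 1 ->
  qBernstein k n m%:~R Q = 'C(n, k)%:R * qint Q m ^+ k * (1 - qint Q m) ^+ (n - k).
Proof.
move=> Q1; rewrite /qBernstein qnum_int // -[1 - m%:~R](@rmorphB _ C intr 1 m).
by rewrite qnum_int ?near1V // qint_invB ?near1_neq0.
Qed.

(** This single evaluation supplies the right-hand sides of both formulas, the first up to the
    factor 'C(n, k). *)
Lemma altlim_qBernstein h n k q zeta :
  pc_abs (q - 1) < 1 -> pc_abs (zeta - 1) < 1 -> (k < n)%N ->
  (1 + q) / 2 * altlim (fun m => qint q m ^+ k * (1 - qint q m) ^+ (n - k) *
                                 (zeta * q ^ h) ^ m) =
  q ^ (h + 1) * zeta * \sum_(0 <= l < k.+1)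
     'C(k, l)%:R * (-1) ^+ (k + l) * qEuler h (n - l) q^-1 zeta^-1 +
  (if k == 0%N then 1 + q else 0).
Proof.
move=> q1 z1 kn; have q0 := near1_neq0 q1; have z0 := near1_neq0 z1.
set u := zeta * q ^ h.
have u1 : pc_abs (u - 1) < 1 by apply: near1M => //; apply: near1Xz.
have uV : u^-1 = zeta^-1 * q^-1 ^ h by rewrite invfM invr_expz exprz_inv.
set G := fun m => _ * u ^ m.
have rq := ucont_qint q1; have rq' := ucont_qint (near1V q1).
have rG : ucont G.
  apply: ucontM (ucont_exp u1); apply: ucontM; apply: ucontX => //.
  exact: ucont_onem.
pose G' m := qint q^-1 m ^+ (n - k) * (1 - qint q^-1 m) ^+ k * u^-1 ^ m.
have rG' : ucont G'.
  apply: ucontM (ucont_exp (near1V u1)); apply: ucontM; apply: ucontX => //.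
  exact: ucont_onem.
(* Reflection swaps [m]_q with 1 - [m]_{q^-1}, and u^(1 - m) leaves one factor u outside. *)
have GG' : (fun m => G (1 - m)) = (fun m => u * G' m).
  apply/funext => m; rewrite /G /G'.
  have E : qint q (1 - m) = 1 - qint q^-1 m.
    by rewrite -[q in LHS]invrK qint_invB // invr_eq0.
  rewrite E subKr expfzDr ?near1_neq0 // expr1z exprz_inv.
  by ring.
have := altlim_reflect rG; rewrite GG' altlimZ // altlim_binom //; last first.
  exact: ucont_exp (near1V u1).
(* G(0) contains 0^k, which is 1 exactly for k = 0; G(1) contains 0^(n - k), which vanishes as k <
   n. *)
rewrite /G qint0 qint1 subrr subr0 expr1n expr0z !mulr1 expr0n.
rewrite [0 ^+ (n - k)]expr0n subn_eq0 leqNgt kn mulr0 mul0r mulr0 addr0.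
move=> /eqP; rewrite eq_sym subr_eq => /eqP ->.
have -> : \sum_(0 <= l < k.+1)
     'C(k, l)%:R * (-1) ^+ (k + l) * qEuler h (n - l) q^-1 zeta^-1 =
   (1 + q^-1) / 2 * \sum_(0 <= l < k.+1) 'C(k, l)%:R * (-1) ^+ l *
     altlim (fun m => qint q^-1 m ^+ (l + (n - k)) * u^-1 ^ m).
  (* Replacing l by k - l matches the index n - l with the exponent l + (n - k), and the sign
     becomes (-1)^l. *)
  rewrite big_nat_rev mulr_sumr /=; apply: eq_big_nat => l /andP[_ lk].
  rewrite add0n subSS qEulerE ?near1V // bin_sub // uV.
  have -> : (n - (k - l) = l + (n - k))%N by lia.
  have -> : (-1) ^+ (k + (k - l)) = (-1) ^+ l :> C.
    by rewrite -signr_odd -[RHS]signr_odd; congr (_ ^+ nat_of_bool _); lia.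
  by ring.
(* The constants agree since 1 + q = q (1 + q^-1); the boundary term 2 G(0) times (1 + q) / 2 gives
   1 + q when k = 0. *)
rewrite expfzDr // expr1z /u.
have two := pc_neq2.
by case: eqP => _ /=; field; rewrite ?q0 ?two.
Qed.

End Padic.

Theorem theorem7 (p : nat) (p_prime : prime p) (p_odd : odd p)
    (R : realType) (C : padicComplex p R)
    (q : C) (q1 : pc_abs (q - 1) < 1) (h : int) (zeta : C) (zetaT : Tp zeta)
    (n k : nat) (lt_kn : (k < n)%N) :
  fermint q (fun x : C =>
      qBernstein k n x q * zppow q ((h - 1)%:~R * x) * zppow zeta x) =
    (if k == 0%N then
       q ^ (h + 1) * zeta * qEuler h n q^-1 zeta^-1 + qnum q 2%:R
     else
       q ^ (h + 1) * zeta * 'C(n, k)%:R *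
       \sum_(0 <= l < k.+1)
          'C(k, l)%:R * (-1) ^+ (k + l) * qEuler h (n - l) q^-1 zeta^-1)
  /\
  \sum_(0 <= l < (n - k).+1)
      'C(n - k, l)%:R * (-1) ^+ l * qEuler h (l + k) q zeta =
    (if k == 0%N then
       q ^ (h + 1) * zeta * qEuler h n q^-1 zeta^-1 + qnum q 2%:R
     else
       q ^ (h + 1) * zeta *
       \sum_(0 <= l < k.+1)
          'C(k, l)%:R * (-1) ^+ (k + l) * qEuler h (n - l) q^-1 zeta^-1).
Proof.
have z1 := near1_Tp p_prime zetaT.
have u1 : pc_abs (zeta * q ^ h - 1) < 1 by apply: near1M => //; apply: near1Xz.
have rq := ucont_qint p_prime q1; have ru := ucont_exp p_prime u1.
have -> : qnum q 2%:R = 1 + q.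
  by rewrite -[2%:R]/(2%:~R) qnum_int // qint2.
have := altlim_qBernstein p_prime p_odd h q1 z1 lt_kn.
set G := fun m => _ * _ ^ m => main.
have rG : ucont G.
  apply: ucontM (ru); apply: ucontM; apply: ucontX => //.
  exact: ucont_onem.
(* It remains to identify both left-hand sides with (1 + q) / 2 times the limit for G, up to 'C(n,
   k) in the first. *)
split.
  have -> : fermint q (fun x : C =>
      qBernstein k n x q * zppow q ((h - 1)%:~R * x) * zppow zeta x) =
      'C(n, k)%:R * ((1 + q) / 2 * altlim G).
    rewrite mulrCA.
    apply: (@fermint_altsum _ _ _ p_prime p_odd q _ (fun m => 'C(n, k)%:R * G m)) => // [m|].
      rewrite -[m%:R]/((Posz m)%:~R) qBernstein_int // /G -zppow_weight //.
      by rewrite -[(Posz m)%:~R]/(m%:R); ring.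
    exact: altsumZ_cvg.
  (* For k = 0 the sum has the single term l = 0, and 'C(n, 0) = 1 leaves the boundary term
     unscaled. *)
  rewrite main; case: eqP => [->|_]; last by rewrite addr0; ring.
  by rewrite big_nat1 bin0 subn0 expr0 !mul1r.
under eq_bigr do rewrite qEulerE // mulrCA.
(* The binomial expansion is read backwards, recombining the Euler numbers into the limit for G. *)
rewrite -mulr_sumr -altlim_binom // main; case: eqP => [->|_].
  by rewrite big_nat1 bin0 subn0 expr0 !mul1r.
by rewrite addr0.
Qed.
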